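(* For every integer $n\ge 7$, $$c_2(n,K_4^-)=\left\lfloor\frac{n}{3}\right\rfloor.$$
   Context: A $3$-graph $H=(V,E)$ consists of a finite vertex set $V$ and an edge set $E\subseteq\binom{V}{3}$. For distinct $a,b\in V$, the codegree $d_H(a,b)$ is the number of vertices $c$ with $\{a,b,c\}\in E$, and the minimum codegree $\delta_2(H)$ is the minimum of $d_H(a,b)$ over all pairs of distinct vertices. For $3$-graphs $F$ and $H$, an $F$-covering of $H$ is a collection of copies of $F$ in $H$ such that every vertex of $H$ lies in at least one of them (i.e. $H$ has an $F$-covering iff every vertex of $H$ is contained in some subgraph of $H$ isomorphic to $F$). Define $c_2(n,F)$ as the maximum of $\delta_2(H)$ over all $3$-graphs $H$ on $n$ vertices having no $F$-covering; equivalently, the maximum integer $t$ such that some $n$-vertex $3$-graph with minimum codegree $t$ has no $F$-covering. $K_4^-$ denotes the $3$-graph on $4$ vertices with $3$ edges (the complete $3$-graph on $4$ vertices with one edge removed). *)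

(* Defs.v *)
From HB Require Import structures.
From mathcomp Require Import all_boot.

Set Implicit Arguments.
Unset Strict Implicit.
Unset Printing Implicit Defensive.

Record threegraph (V : finType) := ThreeGraph {
  edges : {set {set V}};
  edges_card3 : [forall e in edges, #|e| == 3]
}.

HB.instance Definition _ (V : finType) := [isSub for @edges V].
HB.instance Definition _ (V : finType) := [Finite of threegraph V by <:].

(* The vertices c = a and c = b are never counted, as {a, b} is not an edge. *)
Definition codegree (V : finType) (H : threegraph V) (a b : V) : nat :=
  #|[set c | [set a; b; c] \in edges H]|.

(* Every codegree is at most #|V|, so the unit #|V| of the iterated minimum
   matters only when V has fewer than two vertices. *)
Definition min_codegree (V : finType) (H : threegraph V) : nat :=
  \big[minn/#|V|]_(p : V * V | p.1 != p.2) codegree H p.1 p.2.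

(* A pair S = (vertex set, edge set) is a subgraph of H isomorphic to F, the
   isomorphism being f : W -> S.1. *)
Definition is_copy (W V : finType) (F : threegraph W) (H : threegraph V)
    (S : {set V} * {set {set V}}) : bool :=
  [exists f : {ffun W -> V},
    [&& injectiveb f,
        S.1 == [set f w | w in W],
        S.2 == [set f @: (e : {set W}) | e in edges F]
      & S.2 \subset edges H]].

Definition is_covering (W V : finType) (F : threegraph W) (H : threegraph V)
    (C : {set {set V} * {set {set V}}}) : bool :=
  [forall S in C, is_copy F H S] && [forall v, exists S in C, v \in S.1].

Definition has_covering (W V : finType) (F : threegraph W)
    (H : threegraph V) : bool :=
  [exists C, is_covering F H C].

(* The maximum over an empty family is 0; for n > 0 and F with at least one
   edge the family is nonempty, since it contains the edgeless 3-graph. *)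
Definition c2 (W : finType) (n : nat) (F : threegraph W) : nat :=
  \max_(H : threegraph 'I_n | ~~ has_covering F H) min_codegree H.

(* All 3-subsets of {0, 1, 2, 3} except {1, 2, 3}. *)
Definition K4minus_edges : {set {set 'I_4}} :=
  [set e : {set 'I_4} | #|e| == 3] :\ [set~ ord0].

Fact K4minus_card3 : [forall e in K4minus_edges, #|e| == 3].
Proof. by apply/forall_inP => e; rewrite !inE => /andP[]. Qed.

Definition K4minus : threegraph 'I_4 := ThreeGraph K4minus_card3.

(* Main.v *)
(** If v is uncovered and {v,a,b} is an edge, then the neighbourhoods of the
    pairs va, vb and ab are pairwise disjoint: a common vertex c of two of them
    gives three edges on {v,a,b,c}. Hence three times the minimum codegree is at
    most n.

    For the lower bound let k = n/3 and let G be the graph on {0, ..., n-2} in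
    which i and j are adjacent iff k <= |i-j| < 2k; it is an extension of the
    Andrasfai graph, and is triangle-free with minimum degree at least k. Take
    the edges {x,a,b} for ab in G, where x = n-1, and all triples in V \ {x}
    that contain at most one edge of G. A copy of K4- with apex x would be a
    triangle of G, and a copy in which x is not the apex would contain a triple
    with two edges of G. *)

Require Import Defs.
From mathcomp Require Import all_boot zify.

Set Implicit Arguments.
Unset Strict Implicit.
Unset Printing Implicit Defensive.

(** * Bounds on the minimum codegree, and edges as triples *)

Lemma bigminn_leq (I : finType) (P : pred I) (F : I -> nat) (x : nat) (i : I) :
  P i -> \big[minn/x]_(j | P j) F j <= F i.
Proof.
move=> Pi; have := mem_index_enum i; elim: (index_enum I) => //= j r IH.
rewrite inE big_cons => /predU1P[<-|/IH{}IH]; first by rewrite Pi geq_minl.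
by case: ifP => // _; apply: leq_trans IH; apply: geq_minr.
Qed.

(** The bound of [t] by [#|V|] accounts for the unit of the iterated minimum. *)
Lemma leq_min_codegree (V : finType) (H : threegraph V) (t : nat) :
  t <= #|V| -> (forall a b, a != b -> t <= codegree H a b) ->
  t <= min_codegree H.
Proof.
move=> tV tH; rewrite /min_codegree.
elim/big_ind: _ => // [x y tx ty|[a b] /tH //].
by rewrite leq_min tx.
Qed.

Lemma edge_uniq (V : finType) (H : threegraph V) (a b c : V) :
  [set a; b; c] \in edges H -> uniq [:: a; b; c].
Proof.
move=> /(forall_inP (edges_card3 H)) card3.
apply/(@leq_size_uniq _ (enum [set a; b; c])); first exact: enum_uniq.
  by move=> y; rewrite mem_enum !inE -orbA.
by rewrite -cardE (eqP card3).
Qed.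

(** * Coverings in terms of embeddings, and the case of [K4minus] *)

Lemma has_coveringP (W V : finType) (F : threegraph W) (H : threegraph V) :
  reflect (forall v, exists f : W -> V, [/\ injective f, exists w, v = f w
             & forall e, e \in edges F -> f @: e \in edges H])
          (has_covering F H).
Proof.
apply: (iffP existsP) => [[C /andP[/forall_inP CF /forallP covC]] v|cov].
  have /exists_inP[S SC vS] := covC v.
  have /existsP[f /and4P[/injectiveP injf /eqP S1 /eqP S2 /subsetP S2H]] :=
    CF S SC.
  exists f; split=> // [|e eF].
    by move: vS; rewrite S1 => /imsetP[w _ ->]; exists w.
  by apply: S2H; rewrite S2; apply: imset_f.
exists [set S | is_copy F H S]; apply/andP; split.
  by apply/forall_inP => S; rewrite inE.
apply/forallP => v; have [f [injf [w ->] fH]] := cov v.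
apply/exists_inP; exists ([set f u | u in W], [set f @: e | e : {set W} in edges F]).
  rewrite inE; apply/existsP; exists [ffun u => f u].
  have imf (A : {set W}) : [ffun u => f u] @: A = f @: A.
    by apply: eq_imset => u; rewrite ffunE.
  apply/and4P; split=> /=.
  - by apply/injectiveP => u1 u2; rewrite !ffunE => /injf.
  - by apply/eqP/eq_imset => u; rewrite ffunE.
  - by apply/eqP/eq_imset => A; rewrite imf.
  - by apply/subsetP => _ /imsetP[e eF ->]; apply: fH.
exact: imset_f.
Qed.

Definition I4 (i : nat) : 'I_4 := inord i.

Lemma setC1_I4 : [/\ [set~ I4 1] = [set I4 0; I4 2; I4 3],
  [set~ I4 2] = [set I4 0; I4 1; I4 3] & [set~ I4 3] = [set I4 0; I4 1; I4 2]].
Proof.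
by split; apply/setP => -[[|[|[|[|//]]]] ?]; rewrite !inE -!val_eqE /= !inordK.
Qed.

Lemma K4minus_edgeP (e : {set 'I_4}) :
  reflect (e \in [:: [set I4 0; I4 2; I4 3]; [set I4 0; I4 1; I4 3];
                     [set I4 0; I4 1; I4 2]]) (e \in edges K4minus).
Proof.
have [<- <- <-] := setC1_I4; apply: (iffP idP) => /=.
  rewrite !inE => /andP[e0 /eqP e3].
  have /eqP/cards1P[w we] : #|~: e| = 1 by rewrite cardsCs setCK e3 card_ord.
  move: e0; rewrite -[e]setCK we !(inj_eq (@setC_inj _)) !(inj_eq (@set1_inj _)).
  by case: w {we} => -[|[|[|[|//]]]] ?; rewrite /eq_op /= ?inordK.
rewrite !inE => /or3P[] /eqP->; rewrite cardsC1 card_ord andbT;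
by rewrite (inj_eq (@setC_inj _)) (inj_eq (@set1_inj _)) /eq_op /= inordK.
Qed.

(** Here [a] is the apex. Any two of [a], [b], [c], [d] lie in one of the three edges, and edges
    have three elements, so the four vertices are distinct. *)
Lemma K4minus_coveringP (V : finType) (H : threegraph V) :
  reflect (forall v, exists a b c d, [/\ v \in [:: a; b; c; d],
             [set a; b; c] \in edges H, [set a; b; d] \in edges H
             & [set a; c; d] \in edges H])
          (has_covering K4minus H).
Proof.
apply: (iffP (has_coveringP K4minus H)) => cov v.
  have [f [_ [w ->] fH]] := cov v.
  exists (f (I4 0)), (f (I4 1)), (f (I4 2)), (f (I4 3)).
  split; last 3 first.
  - by move: (fH [set I4 0; I4 1; I4 2]); rewrite !imsetU !imset_set1; apply;
      apply/K4minus_edgeP; rewrite !inE eqxx ?orbT.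
  - by move: (fH [set I4 0; I4 1; I4 3]); rewrite !imsetU !imset_set1; apply;
      apply/K4minus_edgeP; rewrite !inE eqxx ?orbT.
  - by move: (fH [set I4 0; I4 2; I4 3]); rewrite !imsetU !imset_set1; apply;
      apply/K4minus_edgeP; rewrite !inE eqxx ?orbT.
  rewrite -(inord_val w); case: w => -[|[|[|[|//]]]] ? /=;
  by rewrite !inE eqxx ?orbT.
have [a [b [c [d [vS abc abd acd]]]]] := cov v.
pose f (i : 'I_4) := nth a [:: a; b; c; d] i.
have fE : [/\ f (I4 0) = a, f (I4 1) = b, f (I4 2) = c & f (I4 3) = d].
  by rewrite /f /I4 !inordK.
exists f; split.
- move=> i j /eqP; rewrite nth_uniq => [/eqP/val_inj//| | |]; rewrite ?ltn_ord //.
  have := edge_uniq abc; have := edge_uniq abd; have := edge_uniq acd.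
  by rewrite /= !inE; do !case: eqP.
- have /(nthP a)[i i4 <-] := vS; exists (inord i); by rewrite /f inordK.
- have [fa fb fc fd] := fE.
  move=> e /K4minus_edgeP; rewrite !inE => /or3P[] /eqP->;
  by rewrite !imsetU !imset_set1 ?fa ?fb ?fc ?fd.
Qed.

(** * The upper bound *)

Lemma uncovered_min_codegree (V : finType) (H : threegraph V) :
  1 < #|V| -> ~~ has_covering K4minus H -> 3 * min_codegree H <= #|V|.
Proof.
(* On a single vertex the minimum would be its unit [#|V|] and the bound would fail. *)
move=> /card_gt1P[y [z [_ _ yz]]] ncov; apply: contraNT ncov.
rewrite -ltnNge => Vlt; apply/K4minus_coveringP => v.
have codegH a b : a != b -> min_codegree H <= codegree H a b.
  by move=> ab; apply: (@bigminn_leq _ _ _ _ (a, b)).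
have d_gt0 : 0 < min_codegree H by case: (min_codegree H) Vlt.
have [a va] : exists a, v != a.
  by case: (eqVneq v y) yz => [->|]; [exists z|exists y].
have /card_gt0P[b] : 0 < codegree H v a by apply: leq_trans (codegH _ _ va).
rewrite inE => vabH; have := edge_uniq vabH.
rewrite /= !inE negb_or andbT => /andP[/andP[_ vb] ab].
pose N (a b : V) := [set c | [set a; b; c] \in edges H].
(* If every [c] lay in at most one of the three neighbourhoods, their sizes would add up to at most
   [#|V|]. *)
have /existsP[c cN] :
    [exists c, 1 < (c \in N v a) + (c \in N v b) + (c \in N a b)].
  apply: contraTT Vlt => /existsPn disj; rewrite -leqNgt.
  apply: (@leq_trans (#|N v a| + #|N v b| + #|N a b|)).
    have [] := (codegH _ _ va, codegH _ _ vb); have := codegH _ _ ab.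
    by rewrite /codegree -/(N v a) -/(N v b) -/(N a b); lia.
  have cardE (A : {set V}) : #|A| = \sum_c (c \in A).
    by rewrite -sum1_card big_mkcond /=; apply: eq_bigr => c _; case: ifP.
  rewrite !cardE -!big_split -sum1_card; apply: leq_sum => c _.
  by rewrite leqNgt; apply: disj.
(* The apex is the common vertex of two pairs that both have [c] as a neighbour: [v], [a] and [b] in
   turn. *)
move: cN; rewrite !inE; case vac: (_ \in _); case vbc: (_ \in _) => /=.
- by exists v, a, b, c; split; rewrite ?inE ?eqxx.
- case abc: (_ \in _) => // _; exists a, v, b, c.
  by split; rewrite ?inE ?eqxx ?orbT // (setUC [set a]).
- case abc: (_ \in _) => // _; exists b, v, a, c.
  split; rewrite ?inE ?eqxx ?orbT // (setUC [set b]) //.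
  by rewrite setUAC.
- by case: (_ \in _).
Qed.

(** * The 3-graph with a prescribed link at [x] *)

Definition link_edges (V : finType) (x : V) (e : rel V) : {set {set V}} :=
  [set S : {set V} | (#|S| == 3) &&
     if x \in S then [exists a in S, exists b in S, e a b]
     else [forall a in S, forall b in S, forall c in S,
             e a b && e a c ==> (b == c)]].

Fact link_edges_card3 (V : finType) (x : V) (e : rel V) :
  [forall S in link_edges x e, #|S| == 3].
Proof. by apply/forall_inP => S; rewrite inE => /andP[]. Qed.

Definition link_graph (V : finType) (x : V) (e : rel V) : threegraph V :=
  ThreeGraph (link_edges_card3 x e).

Lemma cards3_uniq (V : finType) (a b c : V) :
  uniq [:: a; b; c] -> #|[set a; b; c]| = 3.
Proof.
move=> /card_uniqP abc; rewrite -[3]abc; apply: eq_card => y.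
by rewrite !inE -orbA.
Qed.

Section LinkGraph.

Variables (V : finType) (x : V) (e : rel V).
Hypotheses (e_sym : symmetric e) (e_irr : irreflexive e).
Hypothesis e_x : forall a, e x a = false.

Let e_x' a : e a x = false. Proof. by rewrite e_sym. Qed.

Lemma link_graph_apex (a b : V) :
  ([set x; a; b] \in edges (link_graph x e)) = e a b.
Proof.
rewrite inE /= !inE eqxx /=; apply/andP/idP => [[_]|ab]; last first.
  split; last by apply/existsP; exists a; rewrite !inE eqxx orbT;
                 apply/existsP; exists b; rewrite !inE eqxx orbT.
  rewrite cards3_uniq //= !inE andbT negb_or.
  by apply/andP; split; [apply/andP; split|]; apply: contraTneq ab => <-;
     rewrite ?e_x ?e_x' ?e_irr.
case/exists_inP => u; rewrite !inE -orbA => /or3P[]/eqP-> /exists_inP[w];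
by rewrite !inE -orbA => /or3P[]/eqP->; rewrite ?e_x ?e_x' ?e_irr // e_sym.
Qed.

Lemma link_graph_path (a b c : V) :
  a != x -> b != x -> c != x -> e a b -> e a c ->
  [set a; b; c] \notin edges (link_graph x e).
Proof.
move=> ax bx cx ab ac; apply/negP => abcE; have := edge_uniq abcE.
move: abcE; rewrite inE => /andP[_]; rewrite !inE.
rewrite 3!(eq_sym x) (negPf ax) (negPf bx) (negPf cx) /=.
move=> /forall_inP/(_ a)/[!inE]/[!eqxx]/(_ isT)/forall_inP/(_ b).
move=> /[!inE]/[!eqxx]/[!orbT]/(_ isT)/forall_inP/(_ c).
move=> /[!inE]/[!eqxx]/[!orbT]/(_ isT); rewrite ab ac => /eqP->.
by rewrite eqxx andbF.
Qed.

(** Two distinct pairs inside a triple share a vertex, so the condition in [link_edges] that no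
    vertex has two neighbours in the triple amounts to at most one edge of [e]. *)
Lemma link_graph_sparse (a b c : V) :
  a != x -> b != x -> c != x -> uniq [:: a; b; c] ->
  e a b + e b c + e a c <= 1 ->
  [set a; b; c] \in edges (link_graph x e).
Proof.
move=> ax bx cx abc; rewrite inE cards3_uniq //= !inE.
rewrite 3!(eq_sym x) (negPf ax) (negPf bx) (negPf cx) /= => le1.
apply/forall_inP => u uS; apply/forall_inP => v vS; apply/forall_inP => w wS.
apply/implyP=> /andP[]; move: uS vS wS; rewrite !inE -!orbA.
move=> /or3P[]/eqP-> /or3P[]/eqP-> /or3P[]/eqP->; rewrite ?e_irr // ?eqxx //;
move: le1; rewrite ?(e_sym b a) ?(e_sym c b) ?(e_sym c a);
by case: (e a b); case: (e b c); case: (e a c).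
Qed.

Hypothesis e_free : forall a b c, e a b -> e b c -> e a c -> False.

Lemma link_graph_uncovered : ~~ has_covering K4minus (link_graph x e).
Proof.
apply/K4minus_coveringP => /(_ x)[a [b [c [d [+ abc abd acd]]]]].
have [] := And3 (edge_uniq abc) (edge_uniq abd) (edge_uniq acd).
rewrite /= !inE !negb_or !andbT => /andP[/andP[ab ac] bc].
move=> /andP[/andP[_ ad] bd] /andP[_ cd].
(* If [x] is not the apex [a], the two edges through [x] make [a] adjacent to the other two
   vertices, and these form with [a] the third edge. *)
case/or4P => /eqP xE; move: abc abd acd; rewrite -!{}xE in ab ac ad bc bd cd *.
- by rewrite !link_graph_apex => bc' bd' cd'; apply: e_free bc' cd' bd'.
- rewrite !(setUC [set a] [set x]) !link_graph_apex => ac' ad'.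
  by apply/negP/link_graph_path; rewrite // eq_sym.
- rewrite -(setUAC [set a] [set x]) !(setUC [set a] [set x]) !link_graph_apex => ab' abd ad'.
  by move: abd; apply/negP/link_graph_path; rewrite // eq_sym.
- rewrite -!(setUAC [set a] [set x]) !(setUC [set a] [set x]) !link_graph_apex => abc ab' ac'.
  by move: abc; apply/negP/link_graph_path; rewrite // eq_sym.
Qed.

End LinkGraph.

(** * The band graph on the natural numbers below m *)

Definition band (k i j : nat) : bool :=
  (i + k <= j < i + 2 * k) || (j + k <= i < j + 2 * k).

Lemma band_sym (k : nat) : symmetric (band k).
Proof. by move=> i j; rewrite /band orbC. Qed.

Lemma band_irr (k : nat) : irreflexive (band k).
Proof. by move=> i; rewrite /band; lia. Qed.

(** The largest of the three distances is the sum of the other two, hence at least 2k. *)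
Lemma band_triangle_free (k a b c : nat) :
  band k a b -> band k b c -> band k a c -> False.
Proof. by rewrite /band; lia. Qed.

Lemma uniq_iota_cat (i p j q : nat) :
  i + p <= j -> uniq (iota i p ++ iota j q).
Proof.
move=> ipj; rewrite cat_uniq !iota_uniq andbT /=.
by apply/hasPn => c; rewrite !mem_iota; lia.
Qed.

(** The interval of length k above [a] fits below m if a < k, and the one below [a] fits if a >= 2k.
    Otherwise the pieces of both that fit suffice, as m + 1 - 2k >= k. *)
Lemma band_neighbours (k m a : nat) : 3 * k <= m.+1 -> a < m ->
  exists s, [/\ uniq s, k <= size s
              & forall c, c \in s -> c < m /\ band k a c].
Proof.
move=> km am; have [ak|ka] := ltnP a k.
  exists (iota (a + k) k); rewrite iota_uniq size_iota; split=> // c.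
  by rewrite mem_iota /band; lia.
have [ak|ka2] := ltnP a (2 * k).
  exists (iota 0 (a - k).+1 ++ iota (a + k) (minn k (m - (a + k)))).
  rewrite uniq_iota_cat ?size_cat ?size_iota; [|lia].
  split=> // [|c]; first lia.
  by rewrite mem_cat !mem_iota /band; lia.
exists (iota (a - 2 * k).+1 k); rewrite iota_uniq size_iota; split=> // c.
by rewrite mem_iota /band; lia.
Qed.

(** One vertex fewer than k is enough, because [ord_max] will be a further neighbour of an adjacent
    pair. *)
Lemma band_adjacent (k m a b : nat) :
  3 * k <= m.+1 -> a < b < m -> band k a b ->
  exists s, [/\ uniq s, k <= (size s).+1
              & forall c, c \in s ->
                  [/\ c < m, c != a, c != b, ~~ band k b c & ~~ band k a c]].
Proof.
move=> km abm; rewrite {1}/band => ab.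
(* [mid] holds the 2k - 1 - (b - a) vertices at distance less than k from both ends. The missing b -
   a - k are sought below [a], within k of [a] and at least 2k from [b], or symmetrically above
   [b]. *)
pose mid := iota (b - k).+1 (a + 2 * k - b).-1.
have [ak|ka] := ltnP k a.+2.
  exists (iota (a.+1 - k) (b - a - k) ++ mid).
  rewrite uniq_iota_cat ?size_cat ?size_iota; [|lia].
  split=> // [|c]; first lia.
  by rewrite mem_cat !mem_iota /band => cs; split; lia.
have [bk|kb] := leqP (b + k) m.
  exists (mid ++ iota (a + 2 * k) (b - a - k)).
  rewrite uniq_iota_cat ?size_cat ?size_iota; [|lia].
  split=> // [|c]; first lia.
  by rewrite mem_cat !mem_iota /band => cs; split; lia.
(* Here b >= 2k, so the subtraction is exact. What both sides offer, together with [mid], makes m -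
   2k >= k - 1 vertices. *)
exists (iota 0 (b - 2 * k).+1 ++ (mid ++ iota (a + 2 * k) (m - (a + 2 * k)))).
rewrite cat_uniq uniq_iota_cat ?iota_uniq ?size_cat ?size_iota; [|lia].
rewrite andbT; split=> // [| |c]; last 2 first.
- by lia.
- by rewrite !mem_cat !mem_iota /band => cs; split; lia.
by apply/hasPn => c; rewrite !mem_cat !mem_iota; lia.
Qed.

(** A vertex at distance less than k from one end is not adjacent to that end. If the ends are at
    least 2k apart, this gives 2(k - 1) >= k vertices between them. *)
Lemma band_nonadjacent (k m a b : nat) :
  1 < k -> 3 * k <= m.+1 -> a < b < m -> ~~ band k a b ->
  exists s, [/\ uniq s, k <= size s
              & forall c, c \in s ->
                  [/\ c < m, c != a, c != b & ~~ (band k b c && band k a c)]].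
Proof.
move=> k1 km abm; rewrite {1}/band => ab.
have [ab2|ba2] := leqP (a + 2 * k) b.
  exists (iota a.+1 k.-1 ++ iota (b - k).+1 k.-1).
  rewrite uniq_iota_cat ?size_cat ?size_iota; [|lia].
  split=> // [|c]; first lia.
  by rewrite mem_cat !mem_iota /band => cs; split; lia.
have [ak|ka] := ltnP a k.-1.
  (* Now b - a < k, and k - 1 vertices follow [b] closely. The extra one, [z], is next to [a],
     except for the pair 0, 1, where 2k is too far from 0 to be adjacent. *)
  pose z := if a.+1 < b then a.+1 else if 0 < a then a.-1 else 2 * k.
  exists (z :: iota b.+1 k.-1); rewrite /= iota_uniq mem_iota size_iota.
  split=> [| |c]; [by rewrite /z; do 2?case: ifP => ?; lia|by lia|].
  rewrite inE mem_iota => /predU1P[->|]; last by rewrite /band => cs; split; lia.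
  by rewrite /z /band; do 2?case: ifP => ?; split; lia.
(* The mirror case: if [a], [b] are the last two vertices, 0 is too far from [b] to be adjacent. *)
pose z := if a.+1 < b then a.+1 else if b.+1 < m then b.+1 else 0.
exists (z :: iota (a.+1 - k) k.-1); rewrite /= iota_uniq mem_iota size_iota.
split=> [| |c]; [by rewrite /z; do 2?case: ifP => ?; lia|by lia|].
rewrite inE mem_iota => /predU1P[->|]; last by rewrite /band => cs; split; lia.
by rewrite /z /band; do 2?case: ifP => ?; split; lia.
Qed.

(** * Codegrees of the construction, and the conclusion *)

Definition band_rel (k m : nat) : rel 'I_m.+1 :=
  fun i j => [&& i < m, j < m & band k i j].

Lemma size_leq_codegree (n : nat) (H : threegraph 'I_n) (a b : 'I_n)
    (s : seq nat) :
  uniq s ->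
  (forall c, c \in s -> exists2 i : 'I_n, i = c :> nat & [set a; b; i] \in edges H) ->
  size s <= codegree H a b.
Proof.
move=> s_uniq sH; rewrite /codegree cardE -(size_map val).
apply: uniq_leq_size => // c /sH[i <- abi].
by rewrite map_f // mem_enum inE.
Qed.

Lemma codegreeC (V : finType) (H : threegraph V) (a b : V) :
  codegree H a b = codegree H b a.
Proof. by apply: eq_card => c; rewrite !inE (setUC [set a]). Qed.

Lemma band_graph_codegree (k m : nat) (a b : 'I_m.+1) :
  1 < k -> 3 * k <= m.+1 -> a != b ->
  k <= codegree (link_graph ord_max (@band_rel k m)) a b.
Proof.
move=> k1 km.
have e_sym : symmetric (@band_rel k m).
  by move=> i j; rewrite /band_rel band_sym andbCA.
have e_irr : irreflexive (@band_rel k m).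
  by move=> i; rewrite /band_rel band_irr !andbF.
(* The bounds by [m] in [band_rel] isolate [ord_max]. *)
have e_x c : @band_rel k m ord_max c = false by rewrite /band_rel ltnn.
(* With [b] the smaller vertex, only [a] can be [ord_max]. *)
wlog ab : a b / b < a => [hw ba|].
  have /orP[ab|ab] : (b < a) || (a < b) by rewrite -neq_ltn eq_sym.
    exact: hw.
  by rewrite codegreeC; apply: hw; rewrite // eq_sym.
have bm : b < m by apply: leq_trans ab _; rewrite -ltnS.
have [am _|] := eqVneq a ord_max.
  have [s [s_uniq ks sE]] := band_neighbours km bm.
  apply: leq_trans ks _; apply: size_leq_codegree => // c /sE[cm bc].
  exists (inord c); first by rewrite inordK // ltnW.
  by rewrite am link_graph_apex // /band_rel inordK ?bm ?cm // ltnW.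
rewrite -val_eqE /= => am _.
have {}am : a < m by have := ltn_ord a; lia.
have neq_max (i : 'I_m.+1) : i < m -> i != ord_max.
  by move=> im; rewrite -val_eqE /= ltn_eqF.
have bam : b < a < m by rewrite ab.
rewrite codegreeC; have [ba|ba] := boolP (band k b a).
  have [s [s_uniq ks sE]] := band_adjacent km bam ba.
  (* The added [m] is the value of [ord_max]. *)
  apply: (@leq_trans (size (m :: s))) => //; apply: size_leq_codegree.
    by rewrite /= s_uniq andbT; apply/negP => /sE[]; rewrite ltnn.
  move=> c /predU1P[->|/sE[cm ca cb ac bc]].
    exists ord_max => //; rewrite setUC setUA.
    by rewrite link_graph_apex // /band_rel bm am.
  exists (inord c); first by rewrite inordK // ltnW.
  have ci : (inord c : 'I_m.+1) = c :> nat by rewrite inordK // ltnW.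
  apply: link_graph_sparse; rewrite ?neq_max ?ci //.
    by rewrite /= !inE -!val_eqE /= ci; lia.
  by rewrite /band_rel ci cm bm am (negPf ac) (negPf bc) ba.
have [s [s_uniq ks sE]] := band_nonadjacent k1 km bam ba.
apply: leq_trans ks _; apply: size_leq_codegree => // c /sE[cm ca cb abc].
have ci : (inord c : 'I_m.+1) = c :> nat by rewrite inordK // ltnW.
exists (inord c) => //.
apply: link_graph_sparse; rewrite ?neq_max ?ci //.
  by rewrite /= !inE -!val_eqE /= ci; lia.
rewrite /band_rel ci cm bm am (negPf ba) /=.
by move: abc; case: (band k a c); case: (band k b c).
Qed.

Theorem theorem3 (n : nat) (hn : 7 <= n) : c2 n K4minus = n %/ 3.
Proof.
apply/eqP; rewrite eqn_leq; apply/andP; split.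
  apply/bigmax_leqP => H /uncovered_min_codegree; rewrite card_ord; lia.
case: n hn => // m hm; pose k := m.+1 %/ 3.
have [k1 km] : 1 < k /\ 3 * k <= m.+1 by rewrite /k; lia.
pose H := link_graph ord_max (@band_rel k m).
apply: (bigmax_sup H); last first.
  apply: leq_min_codegree => [|a b ab]; first by rewrite card_ord leq_div.
  exact: band_graph_codegree.
apply: link_graph_uncovered.
- by move=> i j; rewrite /band_rel band_sym andbCA.
- by move=> i; rewrite /band_rel band_irr !andbF.
- by move=> c; rewrite /band_rel ltnn.
move=> a b c /and3P[_ _ ab] /and3P[_ _ bc] /and3P[_ _ ac].
exact: band_triangle_free ab bc ac.
Qed.
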